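(* Let $\mathcal{M}$ be a $d$-dimensional $C^\infty$ compact Riemannian manifold without boundary, let $a\in\mathbb{N}$, $m\in\mathbb{Z}_+$, and let $\mathbf{k},\mathbf{r}^0,\ldots,\mathbf{r}^m\in\mathbb{R}^a$ be such that $\mathbf{k}$ belongs to the convex hull of $\mathbf{r}^0,\ldots,\mathbf{r}^m$. Let $\lambda_0,\ldots,\lambda_m>0$ be such that $\lambda_0+\ldots+\lambda_m=1$ and $\mathbf{k}=\lambda_0\mathbf{r}^0+\ldots+\lambda_m\mathbf{r}^m$. Then for every $x\in\bigcap_{j=0}^mH_0^{2\mathbf{r}^j}(\mathcal{M}^a)$, $$\|\mathbf{\Delta}^{\mathbf{k}}x\|_{L_2(\mathcal{M}^a)}\leqslant\prod_{j=0}^m\|\mathbf{\Delta}^{\mathbf{r}^j}x\|_{L_2(\mathcal{M}^a)}^{\lambda_j}.$$ This inequality is sharp and turns into equality on each function $(t_1,\ldots,t_a)\mapsto\varphi_{j_1}(t_1)\cdots\varphi_{j_a}(t_a)$ with $j_1\cdots j_a\neq0$.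
   Context: $\mathbb{Z}_+$ is the set of non-negative integers. $\Delta$ is the positive self-adjoint Laplace–Beltrami operator on $L_2(\mathcal{M})$ (with respect to the Riemannian volume), with eigenvalues counted with multiplicity $0=\mu_0^2<\mu_1^2\leqslant\mu_2^2\leqslant\ldots$ (in particular $\mathcal{M}$ is connected) and $L_2$-orthonormal basis $\{\varphi_j\}_{j=0}^\infty$ of real $C^\infty$ eigenfunctions, $\Delta\varphi_j=\mu_j^2\varphi_j$. $\mathcal{M}^a=\mathcal{M}\times\ldots\times\mathcal{M}$ ($a$ factors) with the product measure. For $\mathbf{j}=(j_1,\ldots,j_a)\in\mathbb{Z}_+^a$ put $\varphi_{\mathbf{j}}(t_1,\ldots,t_a)=\varphi_{j_1}(t_1)\cdots\varphi_{j_a}(t_a)$ and, for $x\in L_2(\mathcal{M}^a)$, $a_{\mathbf{j}}=(x,\varphi_{\mathbf{j}})_{L_2(\mathcal{M}^a)}$. For $\mathbf{s}\in\mathbb{R}^a$, $H_0^{\mathbf{s}}(\mathcal{M}^a)$ is the space of functions $x$ with $a_{\mathbf{j}}=0$ whenever $j_1\cdots j_a=0$ and $\sum_{\mathbf{j}\in\mathbb{N}^a}|a_{\mathbf{j}}|^2\mu_{j_1}^{2s_1}\cdots\mu_{j_a}^{2s_a}<\infty$. The operator $\mathbf{\Delta}^{\mathbf{s}}=\Delta_1^{s_1}\cdots\Delta_a^{s_a}$ ($\Delta_i$ being the Laplace–Beltrami operator acting in the $i$-th coordinate) is $\mathbf{\Delta}^{\mathbf{s}}x=\sum_{\mathbf{j}\in\mathbb{N}^a}a_{\mathbf{j}}\mu_{j_1}^{2s_1}\cdots\mu_{j_a}^{2s_a}\varphi_{\mathbf{j}}$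 for $x\in H_0^{2\mathbf{s}}(\mathcal{M}^a)$. Sharp means that the constant $1$ in front of the product cannot be reduced. *)

(* Defs.v *)
From HB Require Import structures.
From mathcomp Require Import all_boot all_order all_algebra finmap.
From mathcomp Require Import all_classical all_reals all_analysis.
From mathcomp Require Import complex.

Set Implicit Arguments.
Unset Strict Implicit.
Unset Printing Implicit Defensive.

Import Order.TTheory GRing.Theory Num.Theory.
Import numFieldNormedType.Exports.
Local Open Scope classical_set_scope.
Local Open Scope ring_scope.

Section tuple_measure.
Context d (T : measurableType d) (R : realType).

Definition tcons n (p : T * n.-tuple T) : n.+1.-tuple T :=
  [tuple of p.1 :: p.2].

Lemma measurable_tcons n : measurable_fun [set: T * n.-tuple T] (@tcons n).
Proof. exact: measurable_cons. Qed.

Definition cons_measure n (mu : {sigma_finite_measure set T -> \bar R})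
    (nu : {sigma_finite_measure set (n.-tuple T) -> \bar R}) :
    set (n.+1.-tuple T) -> \bar R :=
  pushforward (mu \x nu)%E (@tcons n).

Section cons_measure_instance.
Context (n : nat) (mu : {sigma_finite_measure set T -> \bar R})
  (nu : {sigma_finite_measure set (n.-tuple T) -> \bar R}).

HB.instance Definition _ := Measure.copy (cons_measure mu nu)
  (@measure_function_pushforward__canonical__measure_function_Measure
     _ _ _ _ R (mu \x nu)%E _ (@measurable_tcons n)).

Let cons_measure_sigma_finite : sigma_finite setT (cons_measure mu nu).
Proof.
have /sigma_finiteP[F [UF ndF mF]] := sigma_finiteT mu.
have /sigma_finiteP[G [UG ndG mG]] := sigma_finiteT nu.
pose uncons (t : n.+1.-tuple T) : T * n.-tuple T :=
  (thead t, [tuple of behead t]).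
have unconsK t : tcons (uncons t) = t by rewrite /tcons /= -tuple_eta.
have tconsK p : uncons (tcons p) = p.
  by case: p => x t; rewrite /uncons theadE; congr pair; apply/val_inj.
have muncons : measurable_fun setT uncons.
  apply/measurable_fun_pairP; split; first exact: measurable_tnth.
  exact: measurable_behead.
exists (fun k => uncons @^-1` (F k `*` G k)).
  apply/esym/seteqP; split=> // t _.
  have [k _ Fk] : (\bigcup_k F k) (thead t) by rewrite -UF.
  have [l _ Gl] : (\bigcup_k G k) [tuple of behead t] by rewrite -UG.
  exists (maxn k l) => //; split => /=.
    by move: Fk; exact/subsetPset/ndF/leq_maxl.
  by move: Gl; exact/subsetPset/ndG/leq_maxr.
move=> k; have [mFk finFk] := mF k; have [mGk finGk] := mG k; split.
  rewrite -[X in measurable X]setTI; apply: muncons => //.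
  exact: measurableX.
rewrite /cons_measure /pushforward -comp_preimage.
rewrite (_ : uncons \o _ = id); last exact/funext.
by rewrite preimage_id product_measure1E// lte_mul_pinfty// ge0_fin_numE.
Qed.

HB.instance Definition _ := Measure_isSigmaFinite.Build _ _ _
  (cons_measure mu nu) cons_measure_sigma_finite.
End cons_measure_instance.

Fixpoint pow_measure (mu : {sigma_finite_measure set T -> \bar R}) (n : nat) :
    {sigma_finite_measure set (n.-tuple T) -> \bar R} :=
  if n is n'.+1 then cons_measure mu (pow_measure mu n')
  else \d_([tuple] : 0.-tuple T).

End tuple_measure.

Section complex_L2.
Context d (T : measurableType d) (R : realType).
Context (mu : {measure set T -> \bar R}).
Implicit Types x y : T -> R[i].

Definition L2 x : Prop :=
  (fun t => complex.Re (x t)) \in Lfun mu 2%:E /\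
  (fun t => complex.Im (x t)) \in Lfun mu 2%:E.

Definition cinner x y : R[i] :=
  let z t := x t * conjc (y t) in
  Complex (\int[mu]_t complex.Re (z t)) (\int[mu]_t complex.Im (z t)).

Definition L2norm x : R :=
  fine (Lnorm mu 2%:E (fun t => (Normc.normc (x t))%:E)).

Definition orthonormal_basis (e : nat -> T -> R[i]) : Prop :=
  [/\ forall j, L2 (e j),
      forall i j, cinner (e i) (e j) = (i == j)%:R
    & forall x, L2 x ->
        L2norm (fun t => x t - \sum_(j < n) cinner x (e j) * e j t)
          @[n --> \oo] --> (0 : R)].

(* Unconditional convergence in L2 of the series of the e j over j in J. *)
Definition L2_sums (I : choiceType) (J : {pred I}) (e : I -> T -> R[i]) x :
    Prop :=
  L2 x /\ forall eps : R, 0 < eps -> exists F0 : {fset I},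
    forall F : {fset I}, (F0 `<=` F)%fset ->
      L2norm (fun t => x t - \sum_(j <- F | j \in J) e j t) < eps.

End complex_L2.

Section smooth_functions.
Context (R : realType) (d : nat).
Implicit Types (U : set 'rV[R]_d) (f : 'rV[R]_d -> R).

Definition partial (i : 'I_d) f : 'rV[R]_d -> R :=
  fun v => 'D_(delta_mx 0 i) f v.

Definition smooth_on U f : Prop :=
  forall (s : seq 'I_d) (v : 'rV[R]_d), U v ->
    let g := foldr partial f s in
    {for v, continuous g} /\ forall i, derivable g v (delta_mx 0 i).

End smooth_functions.

(* Only the values of [chart_map] on [chart_dom], and those of [chart_inv] on
   the image of [chart_dom], are meaningful. *)
Record chart (R : realType) (d : nat) (M : topologicalType) := Chart {
  chart_dom : set M;
  chart_map : M -> 'rV[R]_d;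
  chart_inv : 'rV[R]_d -> M;
  chart_dom_open : open chart_dom;
  chart_img_open : open (chart_map @` chart_dom);
  chart_mapK : {in chart_dom, cancel chart_map chart_inv};
  chart_map_continuous : {in chart_dom, continuous chart_map};
  chart_inv_continuous :
    {in chart_map @` chart_dom, continuous chart_inv} }.

Definition chart_img (R : realType) (d : nat) (M : topologicalType)
  (c : chart R d M) : set 'rV[R]_d := chart_map c @` chart_dom c.

Definition transition (R : realType) (d : nat) (M : topologicalType)
  (c c' : chart R d M) : 'rV[R]_d -> 'rV[R]_d :=
  fun v => chart_map c' (chart_inv c v).

Notation borel M := (g_sigma_algebraType (@open M)).

Definition lebesgue_rV (R : realType) (d : nat) :
    {sigma_finite_measure set (d.-tuple (measurableTypeR R)) -> \bar R} :=
  pow_measure lebesgue_measure d.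

Definition row_of_tuple (R : realType) (d : nat) (t : d.-tuple R) : 'rV[R]_d :=
  \row_i tnth t i.

(* The metric is given by its Gram matrices in the charts. As
   [jacobian] acts on row vectors on the right, the transformation rule of a
   covariant 2-tensor reads G = J *m G' *m J^T. A compact space that is locally
   Euclidean is second countable, and its Riemannian volume is finite; a
   Borel measure is determined by its values on the Borel subsets of the
   charts, so [vol_chart] characterizes the Riemannian volume. *)
Record closed_riemannian_manifold (R : realType) (d : nat)
    (M : ptopologicalType) := ClosedRiemannianManifold {
  crm_hausdorff : hausdorff_space M;
  crm_compact : compact [set: M];
  chart_index : Type;
  atlas : chart_index -> chart R d M;
  atlas_cover : forall p, exists i, chart_dom (atlas i) p;
  atlas_smooth : forall i j (k : 'I_d),
    smooth_on (chart_map (atlas i) @` (chart_dom (atlas i) `&`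
                                       chart_dom (atlas j)))
      (fun v => transition (atlas i) (atlas j) v 0 k);
  metric : chart_index -> 'rV[R]_d -> 'M[R]_d;
  metric_smooth : forall i (k l : 'I_d),
    smooth_on (chart_img (atlas i)) (fun v => metric i v k l);
  metric_sym : forall i v, chart_img (atlas i) v ->
    (metric i v)^T = metric i v;
  metric_posdef : forall i v, chart_img (atlas i) v ->
    forall u : 'rV[R]_d, u != 0 -> 0 < (u *m metric i v *m u^T) 0 0;
  metric_transition : forall i j p,
    chart_dom (atlas i) p -> chart_dom (atlas j) p ->
    let v := chart_map (atlas i) p in
    let J := jacobian (transition (atlas i) (atlas j)) v in
    metric i v = J *m metric j (chart_map (atlas j) p) *m J^T;
  vol : {finite_measure set (borel M) -> \bar R};
  vol_chart : forall i (A : set (borel M)),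
    measurable A -> A `<=` chart_dom (atlas i) ->
    vol A = (\int[lebesgue_rV R d]_(t in [set t |
                (chart_map (atlas i) @` A) (row_of_tuple t)])
              (Num.sqrt (\det (metric i (row_of_tuple t))))%:E)%E }.

Arguments atlas {R d M} c i.
Arguments metric {R d M} c i v.

Section laplace_beltrami.
Context (R : realType) (d : nat) (M : ptopologicalType).
Context (g : closed_riemannian_manifold R d M).

Definition smooth_fun (f : M -> R) : Prop :=
  forall i, smooth_on (chart_img (atlas g i)) (f \o chart_inv (atlas g i)).

(* - |g|^(-1/2) \sum_k \partial_k (|g|^(1/2) \sum_l g^{kl} \partial_l f) *)
Definition chart_laplacian (i : chart_index g) (f : M -> R) :
    'rV[R]_d -> R :=
  let G := metric g i in
  let dens v := Num.sqrt (\det (G v)) in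
  let grad k v := \sum_l invmx (G v) k l *
                    partial l (f \o chart_inv (atlas g i)) v in
  fun v => - ((dens v)^-1 *
              \sum_k partial k (fun w => dens w * grad k w) v).

Definition is_laplacian (f h : M -> R) : Prop :=
  forall i p, chart_dom (atlas g i) p ->
    h p = chart_laplacian i f (chart_map (atlas g i) p).

(* [mu j ^+ 2] are the eigenvalues counted with multiplicity; [0 < mu 1] makes
   0 a simple eigenvalue, i.e. M connected. *)
Definition eigenbasis (mu : nat -> R) (phi : nat -> M -> R) : Prop :=
  [/\ mu 0 = 0, 0 < mu 1, forall j, (1 <= j)%N -> mu j <= mu j.+1,
      forall j, smooth_fun (phi j) /\
                is_laplacian (phi j) (fun p => mu j ^+ 2 * phi j p)
    & orthonormal_basis (vol g) (fun j p => (phi j p)%:C%C)].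

End laplace_beltrami.

Section powers.
Context (R : realType) (d : nat) (M : ptopologicalType).
Context (g : closed_riemannian_manifold R d M).
Context (mu : nat -> R) (phi : nat -> M -> R) (a : nat).
Implicit Types (j : a.-tuple nat) (s : 'rV[R]_a).
Implicit Types x y : a.-tuple (borel M) -> R[i].

Definition vola := pow_measure (vol g) a.

Definition nmul : {pred a.-tuple nat} :=
  [pred j : a.-tuple nat | \prod_(i < a) tnth j i != 0]%N.

Definition phia j (t : a.-tuple (borel M)) : R[i] :=
  (\prod_(i < a) phi (tnth j i) (tnth t i))%:C%C.

Definition coef x j : R[i] := cinner vola x (phia j).

(* The eigenvalue of Delta_1^(s_1) ... Delta_a^(s_a) at phia j. *)
Definition mua s j : R := \prod_(i < a) mu (tnth j i) `^ (2 * s 0 i).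

Definition H0 s x : Prop :=
  [/\ L2 vola x,
      forall j, j \notin nmul -> coef x j = 0
    & (\esum_(j in [set` nmul])
         (Normc.normc (coef x j) ^+ 2 * mua s j)%:E < +oo)%E].

(* The L2-sum below is defined up to a null set; it exists for x in
   H0 (2 *: s). *)
Definition laplace_pow s x : a.-tuple (borel M) -> R[i] :=
  xget (fun=> 0)
    [set y | L2_sums vola nmul (fun j t => coef x j * (mua s j)%:C%C * phia j t)
               y].

End powers.

(* Main.v *)
(* The products of the phi_j are orthonormal in L_2(M^a) by Fubini, so by
   Riesz-Fischer and Parseval the squared norm of Delta^s x is the sum of
   |a_j|^2 w_s(j)^2, with w_s(j) = prod_i mu_{j_i}^(2 s_i). These weights are
   log-linear in s, i.e. w_k = prod_l w_{r^l}^(lambda_l), and Hoelder's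
   inequality with exponents 1 / lambda_l concludes. On a single phi_j every sum
   has one term, so equality holds, which also gives sharpness. *)
Require Import Defs.
From HB Require Import structures.
From mathcomp Require Import all_boot all_order all_algebra finmap.
From mathcomp Require Import all_classical all_reals all_analysis.
From mathcomp Require Import complex measurable_realfun.
From mathcomp Require Import ring lra.

Set Implicit Arguments.
Unset Strict Implicit.
Unset Printing Implicit Defensive.

Import Order.TTheory GRing.Theory Num.Theory.
Import numFieldNormedType.Exports.
Local Open Scope classical_set_scope.
Local Open Scope ring_scope.

(** * Square-integrable functions *)

(** [laplace_pow] selects an L2-sum by [xget] with default 0, so its norm cannot be computed until
    such a sum is shown to exist: this is what calls for Riesz-Fischer, hence for completeness of
    L2. Convergence is over finite subsets of an unordered index set, so Parseval and Hoelder are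
    first proved for finite partial sums and then passed to the supremum [\esum]. The basis
    functions are real, so complex functions are split into real and imaginary parts and
    completeness and orthogonality are handled for real functions. The Hoelder bound serves twice:
    its finiteness puts x in the space [H0] for the exponent 2k, and only then does it bound the
    norm of Delta^k x. *)

Lemma Lfun2P d (T : measurableType d) (R : realType)
    (mu : {measure set T -> \bar R}) (f : T -> R) :
  f \in Lfun mu 2%:E <->
  measurable_fun setT f /\ (\int[mu]_t (f t ^+ 2)%:E < +oo)%E.
Proof.
have E : (Lnorm mu 2%:E (EFin \o f) `^ 2 = \int[mu]_t (f t ^+ 2)%:E)%E.
  rewrite poweR_Lnorm//; apply: eq_integral => t _ /=.
  by rewrite powR_mulrn// -normrX ger0_norm// sqr_ge0.
split.
  rewrite inE => /andP[]; rewrite !inE/= => mf nf; split=> //.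
  by rewrite -E; exact: poweR_lty.
move=> [mf nf]; rewrite inE; apply/andP; rewrite !inE/=; split=> //.
by rewrite /finite_norm (@lty_poweRy _ _ 2)// E.
Qed.

Lemma Lfun2D d (T : measurableType d) (R : realType)
    (mu : {measure set T -> \bar R}) (f g : T -> R) :
  f \in Lfun mu 2%:E -> g \in Lfun mu 2%:E -> f \+ g \in Lfun mu 2%:E.
Proof. by have [_ +] := Lfun_addr_closed mu (lee1n 2); exact. Qed.

Lemma Lfun2Z d (T : measurableType d) (R : realType)
    (mu : {measure set T -> \bar R}) (c : R) (f : T -> R) :
  f \in Lfun mu 2%:E -> (fun t => c * f t) \in Lfun mu 2%:E.
Proof.
move=> f2; rewrite (_ : (fun _ => _) = c \o* f); last first.
  by apply/funext => t /=; rewrite mulrC.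
by apply: Lfun_scale => //; rewrite ler1n.
Qed.

(** * Completeness of real L2 along fast Cauchy sequences *)

Section L2_completeness.
Context d (T : measurableType d) (R : realType).
Context (mu : {measure set T -> \bar R}).
Context (u : nat -> T -> R).
Hypothesis u2 : forall n, u n \in Lfun mu 2%:E.
(** The rate is that of a rapidly converging subsequence, already extracted: norms of increments are
    at most 2^-n, which is summable, so the whole sequence converges almost everywhere. *)
Hypothesis ucauchy : forall n m, (n <= m)%N ->
  (\int[mu]_t ((u m t - u n t) ^+ 2)%:E <= ((4^-1) ^+ n)%:E)%E.

Let mu_ n : measurable_fun setT (u n).
Proof. by have /Lfun2P[] := u2 n. Qed.

Let D n t := u n.+1 t - u n t.

(* AM-GM: |D n| <= 2^-n + 2^n (D n)^2, and the last term has a finite sum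
   almost everywhere because its integral is at most 2^-n. *)
Let u_cvg_ae : {ae mu, forall t, cvgn (u ^~ t)}.
Proof.
pose f n t : \bar R := (2 ^+ n * D n t ^+ 2)%:E.
have mD n : measurable_fun setT (D n) by exact: measurable_funB.
have mf n : measurable_fun setT (f n).
  apply/measurable_EFinP; apply: measurable_funM => //.
  exact: measurable_funX.
have f0 n t : (0 <= f n t)%E by rewrite /f lee_fin mulr_ge0 ?sqr_ge0 ?exprn_ge0.
have mg : measurable_fun setT (fun t => \sum_(n <oo) f n t)%E.
  by apply: ge0_emeasurable_sum => // n t _ _; exact: f0.
have : mu.-integrable setT (fun t => \sum_(n <oo) f n t)%E.
  apply/integrableP; split=> //.
  under eq_integral do rewrite gee0_abs ?nneseries_ge0//.
  rewrite integral_nneseries//.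
  (* The k-th integral is at most 2^k * 4^-k = 2^-k, written as 2 / 2^(k+1) to match the known
     geometric series. *)
  apply: (@le_lt_trans _ _ (\sum_(0 <= k <oo) (2 / (2 ^ (k + 1))%:R)%:E)%E).
    apply: lee_nneseries => [n _ _|n _].
      by apply: integral_ge0 => t _; exact: f0.
    rewrite /f; under eq_integral do rewrite EFinM.
    rewrite ge0_integralZl//; last 2 first.
    - by apply/measurable_EFinP; exact: measurable_funX.
    - by move=> t _; rewrite lee_fin sqr_ge0.
    apply: (@le_trans _ _ ((2 ^+ n)%:E * ((4^-1) ^+ n)%:E)%E).
      rewrite lee_wpmul2l ?lee_fin ?exprn_ge0//; exact: ucauchy.
    rewrite -EFinM lee_fin -exprMn addn1 natrX exprS invfM mulrA mulfV// mul1r.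
    rewrite -exprVn; suff -> : 2 * 4^-1 = 2^-1 :> R by [].
    by field.
  have /cvg_lim := @cvg_geometric_eseries_half R 2 0.
  by rewrite /eseries => -> //; exact: ltry.
move=> /integrable_ae -/(_ measurableT).
apply: filterS => t /(_ I) gfin.
have : cvgn (series (fun n => D n t)).
  apply: normed_cvg; apply: nondecreasing_is_cvgn.
    by apply: nondecreasing_series => n _ _ /=.
  (* The 2 bounds the partial sums of 2^-k. *)
  exists (2 + fine (\sum_(n <oo) f n t)%E) => _ [n _ <-] /=.
  rewrite /series/= (@le_trans _ _ (\sum_(0 <= k < n) (2^-1 ^+ k + 2 ^+ k * D k t ^+ 2)))//.
    apply: ler_sum => k _.
    have q0 : 0 < 2 ^+ k :> R by rewrite exprn_gt0.
    rewrite -real_normK ?num_real// exprVn; move: (`|D k t|) (normr_ge0 (D k t)) => x x0.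
    rewrite -(ler_pM2l q0) mulrDr mulfV ?gt_eqF// mulrA.
    move: (2 ^+ k) q0 => q q0.
    have -> : q * q * x ^+ 2 = (q * x) ^+ 2 by ring.
    (* After scaling by q = 2^k the claim is z <= 1 + z^2. *)
    move: (q * x) => z; have := sqr_ge0 (z - 2^-1); nra.
  rewrite big_split/= lerD//.
    suff -> : \sum_(0 <= k < n) 2^-1 ^+ k = 2 - 2 * 2^-1 ^+ n :> R.
      by rewrite gerBl mulr_ge0// exprn_ge0.
    elim: n => [|n IH]; first by rewrite big_nil expr0 mulr1 subrr.
    by rewrite big_nat_recr//= IH exprS; field.
  rewrite -lee_fin fineK// -sumEFin.
  exact: (@nneseries_lim_ge _ (fun k => f k t) xpredT).
move=> /cvg_ex[l Dl]; apply/cvg_ex; exists (u 0%N t + l).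
have -> : u ^~ t = (fun n => u 0%N t + series (fun n => D n t) n).
  apply/funext => n; rewrite /series/= telescope_sumr//.
  by rewrite addrC subrK.
by apply: cvgD => //; exact: cvg_cst.
Qed.

Lemma L2_complete : exists2 y, y \in Lfun mu 2%:E &
  forall n, (\int[mu]_t ((y t - u n t) ^+ 2)%:E <= ((4^-1) ^+ n)%:E)%E.
Proof.
(* The upper limit is measurable and defined at every point; where [u ^~ t] converges, hence almost
   everywhere, it is the limit. [fine] sends infinite values to 0. *)
pose y t := fine (limn_esup (fun n => (u n t)%:E)).
have my : measurable_fun setT y.
  apply: measurableT_comp => //; apply: measurable_fun_limn_esup => n.
  exact/measurable_EFinP.
have uy : {ae mu, forall t, u ^~ t @ \oo --> y t}.
  apply: filterS u_cvg_ae => t /cvg_ex[l ul].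
  have /cvg_limn_einf_sup[_] : (fun n => (u n t)%:E) @ \oo --> l%:E.
    by apply: cvg_EFin => //; exact: nearW.
  by rewrite /y => ->.
have yu n : (\int[mu]_t ((y t - u n t) ^+ 2)%:E <= ((4^-1) ^+ n)%:E)%E.
  have msq m : measurable_fun setT (fun t => ((u m t - u n t) ^+ 2)%:E).
    by apply/measurable_EFinP/measurable_funX/measurable_funB.
  (* Prepares Fatou: almost everywhere the integrand is the lower limit over m of (u m t - u n t)^2,
     whose integrals are at most 4^-n for m >= n. *)
  rewrite (@ge0_ae_eq_integral _ _ _ mu setT _
      (fun t => limn_einf (fun m => ((u m t - u n t) ^+ 2)%:E)))//; last first.
  - apply: filterS uy => t uyt _.
    have /cvg_limn_einf_sup[-> _]// :
      (fun m => ((u m t - u n t) ^+ 2)%:E) @ \oo --> ((y t - u n t) ^+ 2)%:E.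
    apply: cvg_EFin; first exact: nearW.
    by rewrite /comp/=; apply: cvgM; apply: cvgB => //; exact: cvg_cst.
  - move=> t _; rewrite limn_einf_lim; apply: lime_ge; first exact: is_cvg_einfs.
    apply: nearW => N; apply: le_ereal_inf_tmp => _ [m _ <-].
    by rewrite lee_fin sqr_ge0.
  - by move=> t _; rewrite lee_fin sqr_ge0.
  - rewrite /limn_einf; apply: measurableT_comp => //.
    apply: (measurable_fun_limn_esup
      (f := fun m t => - ((u m t - u n t) ^+ 2)%:E)%E) => m.
    exact: measurableT_comp.
  - by apply/measurable_EFinP/measurable_funX/measurable_funB.
  apply: le_trans.
    by apply: fatou => // m t _; rewrite lee_fin sqr_ge0.
  rewrite limn_einf_lim; apply: lime_le; first exact: is_cvg_einfs.
  apply: nearW => N.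
  (* The infimum over the tail from N is at most the member of index [maxn n N], which is also at
     least n, as [ucauchy] requires. *)
  apply: le_trans (ucauchy (leq_maxl n N)); apply: ereal_inf_lbound.
  by exists (maxn n N) => //=; rewrite leq_maxr.
exists y => //.
(* At n = 0 the rate is 4^0 = 1, so y - u 0 is square integrable. *)
have -> : y = (y \- u 0%N) \+ u 0%N by apply/funext => t /=; rewrite subrK.
apply: Lfun2D => //.
apply/Lfun2P; split; first exact: measurable_funB.
by apply: le_lt_trans (yu 0%N) _; rewrite ltry.
Qed.

End L2_completeness.

(** * Complex-valued square-integrable functions *)

Lemma normc_sqr (R : rcfType) (z : R[i]) :
  Normc.normc z ^+ 2 = complex.Re z ^+ 2 + complex.Im z ^+ 2.
Proof. by case: z => a b /=; rewrite sqr_sqrtr// addr_ge0 ?sqr_ge0. Qed.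

Lemma normc_ge0 (R : rcfType) (z : R[i]) : 0 <= Normc.normc z.
Proof. by case: z => a b; exact: sqrtr_ge0. Qed.

Lemma Re_sum (R : rcfType) (I : Type) (s : seq I) (P : pred I) (F : I -> R[i]) :
  complex.Re (\sum_(i <- s | P i) F i) = \sum_(i <- s | P i) complex.Re (F i).
Proof. exact: (big_morph _ (fun x y => raddfD (@complex.Re R) x y)). Qed.

Lemma Im_sum (R : rcfType) (I : Type) (s : seq I) (P : pred I) (F : I -> R[i]) :
  complex.Im (\sum_(i <- s | P i) F i) = \sum_(i <- s | P i) complex.Im (F i).
Proof. exact: (big_morph _ (fun x y => raddfD (@complex.Im R) x y)). Qed.

Lemma Re_mulrC (R : rcfType) (c : R[i]) (x : R) :
  complex.Re (c * x%:C%C) = complex.Re c * x.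
Proof. by case: c => a b /=; rewrite mulr0 subr0. Qed.

Lemma Im_mulrC (R : rcfType) (c : R[i]) (x : R) :
  complex.Im (c * x%:C%C) = complex.Im c * x.
Proof. by case: c => a b /=; rewrite mulr0 add0r. Qed.

Section complex_L2_theory.
Context d (T : measurableType d) (R : realType).
Context (mu : {measure set T -> \bar R}).
Implicit Types x y : T -> R[i].

Lemma L2_measurable_normc x :
  L2 mu x -> measurable_fun setT (fun t => Normc.normc (x t)).
Proof.
move=> [/Lfun2P[mr _] /Lfun2P[mi _]].
rewrite (_ : (fun _ => _) =
    Num.sqrt \o (fun t => complex.Re (x t) ^+ 2 + complex.Im (x t) ^+ 2)).
  apply: measurableT_comp.
    by apply: continuous_measurable_fun; exact: sqrt_continuous.
  by apply: measurable_funD; exact: measurable_funX.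
by apply/funext => t /=; case: (x t).
Qed.

Lemma L2_Lnorm_fin_num x : L2 mu x ->
  Lnorm mu 2%:E (fun t => (Normc.normc (x t))%:E) \is a fin_num.
Proof.
move=> x2; have mx := L2_measurable_normc x2.
rewrite ge0_fin_numE ?Lnorm_ge0//.
suff : (fun t => Normc.normc (x t)) \in Lfun mu 2%:E.
  by rewrite inE => /andP[_]; rewrite !inE.
apply/Lfun2P; split=> //.
case: x2 => /Lfun2P[mr fr] /Lfun2P[mi fi].
under eq_integral do rewrite normc_sqr EFinD.
rewrite ge0_integralD//; last 4 first.
- by move=> t _; rewrite lee_fin sqr_ge0.
- by apply/measurable_EFinP; exact: measurable_funX.
- by move=> t _; rewrite lee_fin sqr_ge0.
- by apply/measurable_EFinP; exact: measurable_funX.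
exact: lte_add_pinfty.
Qed.

Lemma L2norm_sqr x : L2 mu x ->
  ((L2norm mu x ^+ 2)%:E = \int[mu]_t (complex.Re (x t) ^+ 2)%:E
                         + \int[mu]_t (complex.Im (x t) ^+ 2)%:E)%E.
Proof.
move=> x2; have [/Lfun2P[mr _] /Lfun2P[mi _]] := x2.
rewrite /L2norm -powR_mulrn ?fine_ge0 ?Lnorm_ge0// -poweR_EFin.
rewrite fineK ?L2_Lnorm_fin_num// poweR_Lnorm//.
rewrite -ge0_integralD//; last 4 first.
- by move=> t _; rewrite lee_fin sqr_ge0.
- by apply/measurable_EFinP; exact: measurable_funX.
- by move=> t _; rewrite lee_fin sqr_ge0.
- by apply/measurable_EFinP; exact: measurable_funX.
apply: eq_integral => t _ /=.
by rewrite powR_mulrn// -EFinD -normc_sqr ger0_norm// normc_ge0.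
Qed.

Lemma L2norm_ge0 x : 0 <= L2norm mu x.
Proof. by rewrite fine_ge0 ?Lnorm_ge0. Qed.

Lemma L2D x y : L2 mu x -> L2 mu y -> L2 mu (fun t => x t + y t).
Proof.
move=> [xr xi] [yr yi]; split.
  by under eq_fun do rewrite raddfD; exact: (Lfun2D xr yr).
by under eq_fun do rewrite raddfD; exact: (Lfun2D xi yi).
Qed.

Lemma L2N x : L2 mu x -> L2 mu (fun t => - x t).
Proof.
move=> [xr xi]; split.
  by under eq_fun do rewrite raddfN -mulN1r; exact: (Lfun2Z (-1) xr).
by under eq_fun do rewrite raddfN -mulN1r; exact: (Lfun2Z (-1) xi).
Qed.

Lemma L2B x y : L2 mu x -> L2 mu y -> L2 mu (fun t => x t - y t).
Proof. by move=> x2 /L2N; exact: L2D. Qed.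

Lemma L2normN x : L2norm mu (fun t => - x t) = L2norm mu x.
Proof.
rewrite /L2norm; congr fine; apply: eq_Lnorm => t.
by case: (x t) => a b /=; rewrite !sqrrN.
Qed.

(** Minkowski's inequality for the real functions |x| and |y|, combined with the pointwise bound |x
    + y| <= |x| + |y|. *)
Lemma L2norm_triangle x y : L2 mu x -> L2 mu y ->
  L2norm mu (fun t => x t + y t) <= L2norm mu x + L2norm mu y.
Proof.
move=> x2 y2; have mx := L2_measurable_normc x2.
have my := L2_measurable_normc y2; have mxy := L2_measurable_normc (L2D x2 y2).
rewrite -lee_fin EFinD !fineK ?L2_Lnorm_fin_num//; last exact: L2D.
apply: le_trans (minkowski_EFin _ mx my _); last by rewrite ler1n.
rewrite unlock /Lnorm.
rewrite gt0_ler_poweR ?invr_gt0// ?in_itv/= ?leey ?integral_ge0//.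
have E (f : T -> R) : (\int[mu]_t `|(f t)%:E| `^ 2 = \int[mu]_t (f t ^+ 2)%:E)%E.
  apply: eq_integral => t _ /=.
  by rewrite powR_mulrn// -normrX ger0_norm// sqr_ge0.
rewrite !E; apply: ge0_le_integral => //.
- by move=> t _; rewrite lee_fin sqr_ge0.
- by apply/measurable_EFinP; exact: measurable_funX.
- by apply/measurable_EFinP/measurable_funX; exact: measurable_funD.
move=> t _; rewrite lee_fin lerXn2r ?nnegrE ?addr_ge0 ?normc_ge0//.
exact: le_normcD.
Qed.

Lemma L2norm_near x y e : L2 mu x -> L2 mu y ->
  L2norm mu (fun t => x t - y t) < e ->
  `|L2norm mu x - L2norm mu y| < e.
Proof.
move=> x2 y2 xye; rewrite ltr_norml; apply/andP; split.
  rewrite ltrBrDr addrC -ltrBrDr opprK.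
  apply: (@le_lt_trans _ _ (L2norm mu x + L2norm mu (fun t => y t - x t))).
    rewrite [leLHS](_ : _ = L2norm mu (fun t => x t + (y t - x t))).
      by apply: L2norm_triangle => //; exact: L2B.
    by congr L2norm; apply/funext => t; rewrite addrC subrK.
  rewrite ltrD2l -L2normN.
  by under eq_fun do rewrite opprB.
rewrite ltrBlDr (le_lt_trans _ (_ : L2norm mu (fun t => x t - y t) + L2norm mu y < _))//.
  rewrite [leLHS](_ : _ = L2norm mu (fun t => (x t - y t) + y t)).
    by apply: L2norm_triangle => //; exact: L2B.
  by congr L2norm; apply/funext => t; rewrite subrK.
by rewrite ltrD2r.
Qed.

End complex_L2_theory.

(** * Orthonormal expansions *)

Section orthonormal_family.
Context d (T : measurableType d) (R : realType).
Context (mu : {measure set T -> \bar R}).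
Context (I : choiceType) (e : I -> T -> R).
Hypothesis e2 : forall i, e i \in Lfun mu 2%:E.
Hypothesis eo : forall i j, \int[mu]_t (e i t * e j t) = (i == j)%:R.

Lemma Lfun2_lincomb (s : seq I) (P : pred I) (r : I -> R) :
  (fun t => \sum_(i <- s | P i) r i * e i t) \in Lfun mu 2%:E.
Proof.
elim: s => [|i s IH].
  under eq_fun do rewrite big_nil.
  by have [+ _] := Lfun_addr_closed mu (lee1n 2); exact.
case Pi : (P i); under eq_fun do rewrite big_cons Pi; last by [].
by apply: Lfun2D => //; exact: Lfun2Z.
Qed.

Let integrable_mul (f g : T -> R) :
  f \in Lfun mu 2%:E -> g \in Lfun mu 2%:E ->
  mu.-integrable setT (EFin \o (fun t => f t * g t)).
Proof. by move=> f2 g2; apply/Lfun1_integrable; exact: Lfun2_mul_Lfun1. Qed.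

Lemma Rintegral_lincomb_mul (s : seq I) (r : I -> R) (g : T -> R) :
  g \in Lfun mu 2%:E ->
  \int[mu]_t ((\sum_(i <- s) r i * e i t) * g t) =
  \sum_(i <- s) r i * \int[mu]_t (e i t * g t).
Proof.
move=> g2; elim: s => [|i s IH].
  under eq_Rintegral do rewrite big_nil mul0r.
  by rewrite big_nil Rintegral_cst// mul0r.
under eq_Rintegral do rewrite big_cons mulrDl -mulrA.
rewrite RintegralD//; last 2 first.
- have := integrable_mul (Lfun2Z (r i) (e2 i)) g2.
  by under eq_fun do rewrite -mulrA.
- exact: (integrable_mul (Lfun2_lincomb s xpredT r) g2).
by rewrite RintegralZl//= ?IH ?big_cons//; exact: integrable_mul.
Qed.

(** Pythagoras: expanding both factors, only the diagonal terms survive. [uniq] matters, since a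
    repeated index would add its coefficients before squaring. *)
Lemma integral_lincomb_sqr (s : seq I) (P : pred I) (r : I -> R) : uniq s ->
  (\int[mu]_t ((\sum_(i <- s | P i) r i * e i t) ^+ 2)%:E =
   (\sum_(i <- s | P i) r i ^+ 2)%:E)%E.
Proof.
move=> us; under eq_integral do rewrite -big_filter.
rewrite -big_filter; set s' := seq.filter P s.
have us' : uniq s' by rewrite filter_uniq.
have S2 := Lfun2_lincomb s' xpredT r.
transitivity (\int[mu]_t ((\sum_(i <- s') r i * e i t) *
                          (\sum_(i <- s') r i * e i t)))%:E.
  rewrite fineK; last exact/integrable_fin_num/integrable_mul.
  by apply: eq_integral => t _; rewrite expr2.
rewrite Rintegral_lincomb_mul//; congr EFin; apply: eq_big_seq => i is'.
under eq_Rintegral do rewrite mulrC.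
rewrite Rintegral_lincomb_mul// (bigD1_seq i)//= eo eqxx mulr1 big1 ?addr0//.
by move=> j ji; rewrite eo (negbTE ji) mulr0.
Qed.

Implicit Types c : I -> R[i].

Lemma L2_lincomb (s : seq I) (P : pred I) c :
  L2 mu (fun t => \sum_(i <- s | P i) c i * (e i t)%:C%C).
Proof.
split.
  under eq_fun do (rewrite Re_sum; under eq_bigr do rewrite Re_mulrC).
  exact: Lfun2_lincomb.
under eq_fun do (rewrite Im_sum; under eq_bigr do rewrite Im_mulrC).
exact: Lfun2_lincomb.
Qed.

Lemma L2norm_lincomb (s : seq I) (P : pred I) c : uniq s ->
  L2norm mu (fun t => \sum_(i <- s | P i) c i * (e i t)%:C%C) ^+ 2 =
  \sum_(i <- s | P i) Normc.normc (c i) ^+ 2.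
Proof.
move=> us; apply: EFin_inj; rewrite L2norm_sqr; last exact: L2_lincomb.
under eq_integral do (rewrite Re_sum; under eq_bigr do rewrite Re_mulrC).
under [X in (_ + X)%E]eq_integral
  do (rewrite Im_sum; under eq_bigr do rewrite Im_mulrC).
rewrite !integral_lincomb_sqr// -EFinD -big_split/=; congr EFin.
by apply: eq_bigr => i _; rewrite normc_sqr.
Qed.

End orthonormal_family.

Section esum_fset_sums.
Context (R : realType) (I : choiceType) (J : {pred I}) (w : I -> R).
(** With [fset_le_esum], this makes [\esum] the supremum of the sums over [{fset I}] filtered by
    [J], the form in which [L2_sums] takes its partial sums. *)
Lemma esum_le_fsets (M : \bar R) :
  (forall F : {fset I}, (\sum_(i <- F | i \in J) w i)%:E <= M)%E ->
  (\esum_(i in [set` J]) (w i)%:E <= M)%E.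
Proof.
move=> h; apply: ge_ereal_sup => _ [X [finX XJ] <-].
rewrite fsbig_finite//= sumEFin; apply: le_trans (h (fset_set X)).
rewrite lee_fin big_seq_cond [leRHS]big_seq_cond.
rewrite le_eqVlt; apply/orP; left; apply/eqP; apply: eq_bigl => i.
rewrite andbT; case iX : (i \in fset_set X) => //=.
by apply/esym; move: iX; rewrite in_fset_set// => /set_mem/XJ.
Qed.

Lemma fset_le_esum (F : {fset I}) :
  ((\sum_(i <- F | i \in J) w i)%:E <= \esum_(i in [set` J]) (w i)%:E)%E.
Proof.
apply: esum_ge; exists [set` [fset i in F | i \in J]%fset].
  split; first exact: finite_fset.
  by move=> i /=; rewrite !inE/= => /andP[].
rewrite fsbig_finite//= set_fsetK big_fset_condE/= sumEFin lee_fin.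
by rewrite le_eqVlt; apply/orP; left; apply/eqP/congr_big.
Qed.

(** A difference of nested partial sums is again a partial sum, so Pythagoras also yields the Cauchy
    estimates. *)
Lemma fset_sum_sub (V : zmodType) (f : I -> V) (F G : {fset I}) :
  (F `<=` G)%fset ->
  \sum_(i <- G | i \in J) f i - \sum_(i <- F | i \in J) f i =
  \sum_(i <- [fset i in G | i \notin F]%fset | i \in J) f i.
Proof.
move=> FG; rewrite [X in X - _](big_fsetIDcond _ (mem F))/=.
have -> : [fset x in G | x \in F]%fset = F.
  by apply/fsetP => i; rewrite !inE/= andb_idl// => /(fsubsetP FG).
by rewrite [X in X - _]addrC addrK.
Qed.

End esum_fset_sums.

Section Riesz_Fischer.
Context d (T : measurableType d) (R : realType).
Context (mu : {measure set T -> \bar R}).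
Context (I : choiceType) (J : {pred I}) (e : I -> T -> R) (c : I -> R[i]).
Hypothesis e2 : forall i, e i \in Lfun mu 2%:E.
Hypothesis eo : forall i j, \int[mu]_t (e i t * e j t) = (i == j)%:R.

Let w i : R := Normc.normc (c i) ^+ 2.
Let S (F : {fset I}) : R := \sum_(i <- F | i \in J) w i.
Let s (F : {fset I}) t := \sum_(i <- F | i \in J) c i * (e i t)%:C%C.

Let w0 i : 0 <= w i. Proof. exact: sqr_ge0. Qed.

Let s2 F : L2 mu (s F). Proof. exact: L2_lincomb. Qed.

Let norm_s F : L2norm mu (s F) ^+ 2 = S F.
Proof. by rewrite L2norm_lincomb// fset_uniq. Qed.

Let norm_sB (F G : {fset I}) : (F `<=` G)%fset ->
  L2norm mu (fun t => s G t - s F t) ^+ 2 = S G - S F.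
Proof.
move=> FG; rewrite [RHS]fset_sum_sub//.
under [X in L2norm _ X]eq_fun do rewrite fset_sum_sub//.
by rewrite L2norm_lincomb// fset_uniq.
Qed.

Let leS (F G : {fset I}) : (F `<=` G)%fset -> S F <= S G.
Proof. by move=> FG; rewrite -subr_ge0 -norm_sB// sqr_ge0. Qed.

(** Parseval: the norms of the partial sums increase with the finite set and come arbitrarily close
    to the norm of [y], which is therefore their supremum. *)
Lemma L2_sums_norm y : L2_sums mu J (fun i t => c i * (e i t)%:C%C) y ->
  ((L2norm mu y ^+ 2)%:E =
   \esum_(i in [set` J]) (Normc.normc (c i) ^+ 2)%:E)%E.
Proof.
move=> [y2 sy]; rewrite -/w.
have near_s (eps : R) : 0 < eps -> exists F0 : {fset I}, forall F : {fset I},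
    (F0 `<=` F)%fset -> `|L2norm mu y - L2norm mu (s F)| < eps.
  move=> /sy[F0 F0y]; exists F0 => F /F0y; exact: (L2norm_near y2 (s2 F)).
have N0 := L2norm_ge0 mu.
have Sy F : L2norm mu (s F) <= L2norm mu y.
  (* The approximation holds only beyond F0, so F is enlarged to F0 union F, which does not decrease
     the norm of the partial sum. *)
  apply/ler_addgt0Pr => eps /near_s[F0 /(_ (F0 `|` F)%fset)].
  rewrite fsubsetUl => /(_ isT); rewrite ltr_norml => /andP[+ _].
  rewrite ltrNl opprB ltrBlDr addrC => /ltW; apply: le_trans.
  rewrite -(@ler_pXn2r _ 2)// ?nnegrE// !norm_s; apply: leS.
  exact: fsubsetUr.
apply/eqP; rewrite eq_le; apply/andP; split; last first.
  apply: esum_le_fsets => F; rewrite lee_fin -/(S F) -norm_s.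
  by rewrite lerXn2r// nnegrE.
case: (\esum_(_ in _) _)%E (fset_le_esum J w) => [E SE| |/(_ fset0)//];
  last by rewrite leey.
have E0 : 0 <= E.
  rewrite -lee_fin; apply: le_trans (SE fset0).
  by rewrite lee_fin; apply: sumr_ge0.
rewrite lee_fin -(@sqr_sqrtr _ E)// lerXn2r ?nnegrE ?sqrtr_ge0//.
apply/ler_addgt0Pr => eps /near_s[F /(_ F (fsubset_refl F))].
rewrite ltr_norml => /andP[_]; rewrite ltrBlDr addrC => /ltW/le_trans; apply.
rewrite lerD2r -(@ler_pXn2r _ 2)// ?nnegrE ?sqrtr_ge0// norm_s sqr_sqrtr//.
by have := SE F; rewrite lee_fin.
Qed.

(* The partial sums over finite sets [H n] whose tails are at most 4^-n converge
   in norm; a sum over any finite set containing [H n] is within 2^-n of them,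
   hence the convergence is unconditional. *)
Lemma Riesz_Fischer :
  (\esum_(i in [set` J]) (Normc.normc (c i) ^+ 2)%:E < +oo)%E ->
  exists y, L2_sums mu J (fun i t => c i * (e i t)%:C%C) y.
Proof.
rewrite -/w => Efin.
pose E := fine (\esum_(i in [set` J]) (w i)%:E)%E.
have EE : (E%:E = \esum_(i in [set` J]) (w i)%:E)%E.
  by rewrite fineK// ge0_fin_numE// esum_ge0// => i _; rewrite lee_fin.
have SE F : S F <= E by rewrite -lee_fin EE; exact: fset_le_esum.
have q0 n : 0 < 4^-1 ^+ n :> R by rewrite exprn_gt0.
have /choice[G GE] n : exists F : {fset I}, E - 4^-1 ^+ n < S F.
  apply/not_existsP => h.
  have : (\esum_(i in [set` J]) (w i)%:E <= (E - 4^-1 ^+ n)%:E)%E.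
    by apply: esum_le_fsets => F; rewrite lee_fin leNgt; apply/negP/h.
  by rewrite -EE lee_fin leNgt ltrBlDr ltrDl q0.
pose H := fix H n := if n is n'.+1 then (H n' `|` G n)%fset else G 0%N.
have HE n : E - 4^-1 ^+ n < S (H n).
  by apply: lt_le_trans (GE n) (leS _); case: n => //= n; exact: fsubsetUr.
have leH n m : (n <= m)%N -> (H n `<=` H m)%fset.
  elim: m => [|m IH]; first by rewrite leqn0 => /eqP ->.
  rewrite leq_eqVlt ltnS => /predU1P[->//|/IH/fsubset_trans]; apply.
  exact: fsubsetUl.
have Hs n F : (H n `<=` F)%fset ->
    L2norm mu (fun t => s F t - s (H n) t) ^+ 2 <= 4^-1 ^+ n.
  move=> HF; rewrite norm_sB//; have := HE n; have := SE F; lra.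
have int_s n m : (n <= m)%N ->
    (\int[mu]_t (complex.Re (s (H m) t - s (H n) t) ^+ 2)%:E
     + \int[mu]_t (complex.Im (s (H m) t - s (H n) t) ^+ 2)%:E
     <= (4^-1 ^+ n)%:E)%E.
  by move=> /leH/Hs; rewrite -lee_fin L2norm_sqr//; exact: L2B.
have sqr_int_ge0 (f : T -> R) : (0 <= \int[mu]_t (f t ^+ 2)%:E)%E.
  by apply: integral_ge0 => t _; rewrite lee_fin sqr_ge0.
have [|yr yr2 yrs] := L2_complete (u := fun n t => complex.Re (s (H n) t))
  (fun n => (s2 (H n)).1).
  move=> n m /int_s; apply: le_trans; rewrite -[leLHS]adde0 leeD//.
  by under eq_integral do rewrite -raddfB.
have [|yi yi2 yis] := L2_complete (u := fun n t => complex.Im (s (H n) t))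
  (fun n => (s2 (H n)).2).
  move=> n m /int_s; apply: le_trans; rewrite -[leLHS]add0e leeD//.
  by under eq_integral do rewrite -raddfB.
pose y t := Complex (yr t) (yi t).
have y2 : L2 mu y by split.
exists y; split=> // eps eps0.
(* 3 = 2 + 1: the distance from y to the sum over [H n] is at most 2 * 2^-n, as its real and
   imaginary parts each contribute 4^-n to the square, and that from the latter to the sum over F is
   at most 2^-n. *)
have [n nE] : exists n, 3 / 2 ^+ n < eps.
  exists (Num.bound (3 / eps)); rewrite ltr_pdivrMr ?exprn_gt0// mulrC.
  by rewrite -ltr_pdivrMr//; apply: upper_nthrootP.
exists (H n) => F HF; apply: le_lt_trans nE.
have half2 : (2^-1 ^+ n) ^+ 2 = 4^-1 ^+ n :> R.
  by rewrite exprAC; congr (_ ^+ n); field.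
have h0 : 0 <= 2^-1 ^+ n :> R by rewrite exprn_ge0.
have -> : (fun t => y t - s F t) =
    (fun t => (y t - s (H n) t) + - (s F t - s (H n) t)).
  by apply/funext => t; rewrite opprB addrA subrK.
apply: le_trans (L2norm_triangle _ _) _; [exact: L2B|exact/L2N/L2B|].
have -> : 3 / 2 ^+ n = 2 * 2^-1 ^+ n + 2^-1 ^+ n :> R by rewrite exprVn; field.
apply: lerD; last first.
  rewrite L2normN -(@ler_pXn2r _ 2)// ?nnegrE ?L2norm_ge0// half2.
  exact: Hs.
rewrite -(@ler_pXn2r _ 2)// ?nnegrE ?L2norm_ge0 ?mulr_ge0// exprMn half2.
rewrite -lee_fin L2norm_sqr; last exact: L2B.
apply: (@le_trans _ _ ((4^-1 ^+ n)%:E + (4^-1 ^+ n)%:E)%E).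
  apply: leeD.
    by under eq_integral do rewrite raddfB; exact: yrs.
  by under eq_integral do rewrite raddfB; exact: yis.
rewrite -EFinD lee_fin; have := ltW (q0 n); nra.
Qed.

End Riesz_Fischer.

(** * Product functions on tuples *)

Section product_functions.
Context d1 d2 (T1 : measurableType d1) (T2 : measurableType d2) (R : realType).
Context (m1 : {sigma_finite_measure set T1 -> \bar R}).
Context (m2 : {sigma_finite_measure set T2 -> \bar R}).
Context (f : T1 -> R) (g : T2 -> R).
Hypothesis fi : m1.-integrable setT (EFin \o f).
Hypothesis gi : m2.-integrable setT (EFin \o g).

Let fg (p : T1 * T2) : \bar R := (f p.1 * g p.2)%:E.

Lemma integrable_prod_mul : (m1 \x m2)%E.-integrable setT fg.
Proof.
have /measurable_EFinP mf := measurable_int _ fi.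
have /measurable_EFinP mg := measurable_int _ gi.
apply/integrable12ltyP.
  by apply/measurable_EFinP; apply: measurable_funM => /=;
    exact: measurableT_comp.
have /integrableP[_ f1] := fi; have /integrableP[_ g1] := gi.
rewrite (_ : (\int[m1]_x _)%E =
    (\int[m1]_x `|(f x)%:E| * \int[m2]_y `|(g y)%:E|)%E).
  by rewrite lte_mul_pinfty// ?integral_ge0// ge0_fin_numE ?integral_ge0.
rewrite -ge0_integralZr//; last 2 first.
- by apply: measurableT_comp => //; exact/measurable_EFinP.
- exact: integral_ge0.
apply: eq_integral => x _; rewrite -ge0_integralZl//.
- by apply: eq_integral => y _; rewrite /fg EFinM abseM.
- by apply: measurableT_comp => //; exact/measurable_EFinP.
Qed.

Lemma Rintegral_prod_mul :
  \int[(m1 \x m2)%E]_p (f p.1 * g p.2) = \int[m1]_x f x * \int[m2]_y g y.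
Proof.
have gfin : (\int[m2]_y (g y)%:E)%E \is a fin_num by exact: integrable_fin_num.
rewrite /Rintegral -(integral12_prod_meas1 integrable_prod_mul) /fubini_F.
rewrite -fineM//; last exact: integrable_fin_num.
congr fine; rewrite -[X in (_ * X)%E]fineK// -integralZr//.
apply: eq_integral => x _ /=.
by rewrite fineK// -integralZl//; apply: eq_integral => y _; rewrite EFinM.
Qed.

End product_functions.

Section tuple_product_functions.
Context d (T : measurableType d) (R : realType).
Context (mu : {sigma_finite_measure set T -> \bar R}).

Lemma measurable_tuple_prod n (f : 'I_n -> T -> R) :
  (forall i, measurable_fun setT (f i)) ->
  measurable_fun setT (fun t : n.-tuple T => \prod_(i < n) f i (tnth t i)).
Proof.
move=> mf; apply: measurable_prod => i _.
by apply: measurableT_comp => //; exact: measurable_tnth.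
Qed.

(** Induction on n: pulling back along [tcons] turns the integral into one over a product measure,
    where Fubini applies. The two claims go together because Fubini needs the tail product to be
    integrable. *)
Lemma pow_measure_prod n (f : 'I_n -> T -> R) :
  (forall i, mu.-integrable setT (EFin \o f i)) ->
  (pow_measure mu n).-integrable setT
    (fun t => (\prod_(i < n) f i (tnth t i))%:E) /\
  \int[pow_measure mu n]_t (\prod_(i < n) f i (tnth t i)) =
    \prod_(i < n) \int[mu]_x f i x.
Proof.
elim: n f => [|n IH] f fi.
  under eq_fun do rewrite big_ord0.
  under eq_Rintegral do rewrite big_ord0.
  rewrite big_ord0; split.
    apply/integrableP; split=> //.
    by rewrite integral_dirac//= diracT mul1e ltry.
  by rewrite /Rintegral integral_dirac// diracT mul1e.
have [gi gE] := IH (fun i => f (lift ord0 i)) (fun i => fi (lift ord0 i)).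
have mf : measurable_fun setT
    (fun t : n.+1.-tuple T => (\prod_(i < n.+1) f i (tnth t i))%:E).
  apply/measurable_EFinP; apply: measurable_tuple_prod => i.
  by apply/measurable_EFinP; exact: measurable_int (fi i).
have fE : (fun t : n.+1.-tuple T => (\prod_(i < n.+1) f i (tnth t i))%:E) \o
      @tcons _ T n =
    (fun p => (f ord0 p.1 * \prod_(i < n) f (lift ord0 i) (tnth p.2 i))%:E).
  apply/funext => -[x t] /=; rewrite big_ord_recl tnth0; congr (_ * _)%:E.
  by apply: eq_bigr => i _; rewrite tnthS.
have fi' : (mu \x pow_measure mu n)%E.-integrable (@tcons _ T n @^-1` setT)
    ((fun t : n.+1.-tuple T => (\prod_(i < n.+1) f i (tnth t i))%:E) \o
     @tcons _ T n).
  by rewrite fE preimage_setT; exact: (integrable_prod_mul (fi ord0) gi).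
split.
  exact: (integrable_pushforward (@measurable_tcons _ T n) mf fi').
rewrite /Rintegral.
rewrite [X in fine X](integral_pushforward (@measurable_tcons _ T n) mf fi')//.
rewrite fE preimage_setT [LHS](Rintegral_prod_mul (fi ord0) gi) gE.
by rewrite big_ord_recl.
Qed.

Lemma orthonormal_tuple_prod n (phi : nat -> T -> R) :
  (forall j, phi j \in Lfun mu 2%:E) ->
  (forall i j, \int[mu]_x (phi i x * phi j x) = (i == j)%:R) ->
  let e (j : n.-tuple nat) t := \prod_(i < n) phi (tnth j i) (tnth t i) in
  (forall j, e j \in Lfun (pow_measure mu n) 2%:E) /\
  (forall i j, \int[pow_measure mu n]_t (e i t * e j t) = (i == j)%:R).
Proof.
move=> phi2 phio e.
have phii i j : mu.-integrable setT (EFin \o (fun x => phi i x * phi j x)).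
  by apply/Lfun1_integrable; exact: Lfun2_mul_Lfun1.
split=> [j|i j].
  apply/Lfun2P; split.
    apply: (measurable_tuple_prod (f := fun i => phi (tnth j i))) => i.
    by have /Lfun2P[] := phi2 (tnth j i).
  (* The square of a product function is the product of the squares, each integrable. *)
  have [/integrableP[_] + _] := pow_measure_prod
    (fun i => phii (tnth j i) (tnth j i)).
  apply: le_lt_trans; rewrite le_eqVlt; apply/orP; left; apply/eqP.
  apply: eq_integral => t _; rewrite big_split/= -expr2 ger0_norm//.
  exact: sqr_ge0.
have [_] := pow_measure_prod (fun k => phii (tnth i k) (tnth j k)).
under eq_Rintegral do rewrite big_split.
move=> ->; under eq_bigr do rewrite phio.
rewrite -natr_prod; congr (_%:R).
have [->|/eqP ij] := eqVneq i j.
  by rewrite big1// => k _; rewrite eqxx.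
have [k kij] : exists k, tnth i k != tnth j k.
  by apply/existsP; apply: contra_notT ij; rewrite negb_exists => /forallP h;
    apply: eq_from_tnth => k; apply/eqP; rewrite -[_ == _]negbK.
by rewrite (bigD1 k)//= (negbTE kij).
Qed.

End tuple_product_functions.

(** * Interpolation *)

Section hoelder_fsets.
Context (R : realType) (m : nat) (lam : 'I_m -> R).
Hypothesis lam0 : forall l, 0 < lam l.
Hypothesis lam1 : \sum_l lam l = 1.

(* Tangent line of exp at [g = \sum_l lam l * ln (x l)]. *)
Lemma weighted_AGM (x : 'I_m -> R) : (forall l, 0 < x l) ->
  \prod_l x l `^ lam l <= \sum_l lam l * x l.
Proof.
move=> x0; set g := \sum_l lam l * ln (x l).
have -> : \prod_l x l `^ lam l = expR g.
  by rewrite expR_sum; apply: eq_bigr => l _; rewrite /powR gt_eqF.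
have le_x l : expR g * (1 + (ln (x l) - g)) <= x l.
  rewrite -[leRHS](@lnK _ (x l)) ?posrE// -[in leRHS](subrK g (ln (x l))).
  by rewrite expRD mulrC ler_wpM2r ?expR_ge0// expR_ge1Dx.
apply: (@le_trans _ _ (\sum_l lam l * (expR g * (1 + (ln (x l) - g))))).
  under eq_bigr do rewrite mulrCA mulrDr mulr1 mulrBr.
  rewrite -mulr_sumr big_split/= sumrB -mulr_suml lam1 -/g mul1r subrr addr0.
  by rewrite mulr1.
by apply: ler_sum => l _; rewrite ler_pM2l.
Qed.

(** After dividing each weight [w l] by [s l], the weighted AM-GM inequality bounds each term, and
    summation gives the factor [\sum_l lam l = 1]. The bounds [s l] are uniform over finite sets,
    which suits the passage to [\esum]. *)
Lemma hoelder_fsets (I : choiceType) (J : {pred I}) (c : I -> R)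
    (w : 'I_m -> I -> R) (s : 'I_m -> R) :
  (forall i, 0 <= c i) -> (forall l i, i \in J -> 0 < w l i) ->
  (forall l (F : {fset I}), \sum_(i <- F | i \in J) c i * w l i <= s l) ->
  forall F : {fset I},
    \sum_(i <- F | i \in J) c i * \prod_l w l i `^ lam l
    <= \prod_l s l `^ lam l.
Proof.
move=> c0 w0 ws F.
have P0 : 0 <= \prod_l s l `^ lam l by apply: prodr_ge0 => l _; exact: powR_ge0.
have [/forallP s0|] := boolP [forall l, 0 < s l]; last first.
  rewrite negb_forall => /existsP[l]; rewrite -leNgt => sl0.
  rewrite big1// => i iJ.
  suff -> : c i = 0 by rewrite mul0r.
  (* If some [s l] is not positive, one-element sets already force c to vanish on J, so the left
     side is 0. *)
  have := ws l [fset i]%fset; rewrite big_mkcond big_seq_fset1 iJ.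
  move=> /le_trans/(_ sl0); rewrite pmulr_lle0 ?w0// => ci0.
  by apply/eqP; rewrite eq_le ci0 c0.
set P := \prod_l _ in P0 *.
apply: (@le_trans _ _
    (\sum_(i <- F | i \in J) c i * (P * \sum_l lam l * (w l i / s l)))).
  apply: ler_sum => i iJ; apply: ler_wpM2l => //.
  have -> : \prod_l w l i `^ lam l = P * \prod_l (w l i / s l) `^ lam l.
    rewrite -big_split/=; apply: eq_bigr => l _.
    rewrite -powRM ?divr_ge0 ?(ltW (s0 l)) ?(ltW (w0 l i iJ))//.
    by rewrite mulrCA divff ?mulr1// gt_eqF.
  by apply: ler_wpM2l => //; apply: weighted_AGM => l; rewrite divr_gt0 ?w0.
rewrite (_ : \sum_(_ <- _ | _) _ =
    P * \sum_l lam l * ((\sum_(i <- F | i \in J) c i * w l i) / s l)).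
  rewrite -[leRHS]mulr1 ler_wpM2l// -[leRHS]lam1; apply: ler_sum => l _.
  rewrite -[leRHS]mulr1 ler_pM2l// ler_pdivrMr// mul1r; exact: ws.
rewrite mulr_sumr; under eq_bigr do rewrite mulr_sumr mulr_sumr.
rewrite exchange_big/=; apply: eq_bigr => l _.
by rewrite mulr_suml !mulr_sumr; apply: eq_bigr => i _; ring.
Qed.

End hoelder_fsets.

(** * Powers of the Laplacian on the product manifold *)

Section powers_theory.
Context (R : realType) (d : nat) (M : ptopologicalType).
Context (g : closed_riemannian_manifold R d M).
Context (mu : nat -> R) (phi : nat -> M -> R) (hphi : eigenbasis g mu phi).
Context (a : nat).
Local Notation nmul := (@nmul a).
Implicit Types (j n : a.-tuple nat) (s : 'rV[R]_a).
Implicit Types x : a.-tuple (borel M) -> R[i].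

Let mu_gt0 i : i != 0%N -> 0 < mu i.
Proof.
have [_ mu1 muS _ _] := hphi; case: i => // i _.
by elim: i => // i IH; apply: lt_le_trans IH (muS _ _).
Qed.

Let nmul_gt0 j i : j \in nmul -> 0 < mu (tnth j i).
Proof.
rewrite inE => j0; apply: mu_gt0; apply: contra j0 => ji.
by rewrite (bigD1 i)//= (eqP ji) mul0n.
Qed.

(** On [nmul] every base is positive, so the weight is the exponential of a form linear in s. A zero
    index would bring in the base [mu 0 = 0], where real powers lose this form. *)
Lemma mua_expR s j : j \in nmul ->
  mua mu s j = expR (\sum_(i < a) 2 * s 0 i * ln (mu (tnth j i))).
Proof.
move=> j0; rewrite expR_sum; apply: eq_bigr => i _.
by rewrite /powR gt_eqF// nmul_gt0.
Qed.

Lemma mua_gt0 s j : j \in nmul -> 0 < mua mu s j.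
Proof. by move=> j0; rewrite mua_expR// expR_gt0. Qed.

(** Reconciles the weight defining [H0] at 2s with the square of the multiplier of Delta^s. *)
Lemma mua_scale2 s j : j \in nmul -> mua mu (2 *: s) j = mua mu s j ^+ 2.
Proof.
move=> j0; rewrite !mua_expR// -expRM_natl; congr expR.
by rewrite mulr_sumr; apply: eq_bigr => i _; rewrite mxE; ring.
Qed.

Lemma mua_lincomb m (lam : 'I_m -> R) (r : 'I_m -> 'rV[R]_a) j : j \in nmul ->
  mua mu (\sum_l lam l *: r l) j = \prod_l mua mu (r l) j `^ lam l.
Proof.
move=> j0; rewrite mua_expR//; under [RHS]eq_bigr do rewrite mua_expR// -expRM.
rewrite -expR_sum; congr expR; under [RHS]eq_bigr do rewrite mulr_suml.
rewrite exchange_big; apply: eq_bigr => i _.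
rewrite summxE mulr_sumr mulr_suml; apply: eq_bigr => l _.
by rewrite mxE; ring.
Qed.

Let e j (t : a.-tuple (borel M)) : R := \prod_(i < a) phi (tnth j i) (tnth t i).

Let e_orthonormal :
  (forall j, e j \in Lfun (vola g a) 2%:E) /\
  (forall i j, \int[vola g a]_t (e i t * e j t) = (i == j)%:R).
Proof.
have [_ _ _ _ [phi2 phio _]] := hphi.
apply: orthonormal_tuple_prod => [j|i j]; first exact: (phi2 j).1.
(* For real functions the real part of the complex inner product is the real one. *)
have /(congr1 (@complex.Re R)) := phio i j; rewrite /cinner/=.
under eq_Rintegral do rewrite oppr0 mulr0 subr0.
by move=> ->; case: (i == j).
Qed.

Lemma L2norm_laplace_pow s x : H0 g mu phi (2 *: s) x ->
  ((L2norm (vola g a) (laplace_pow g mu phi s x) ^+ 2)%:E =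
   \esum_(j in [set` nmul])
     (Normc.normc (coef g phi x j) ^+ 2 * mua mu (2 *: s) j)%:E)%E.
Proof.
move=> [_ _ xs]; have [e2 eo] := e_orthonormal.
pose c j := coef g phi x j * (mua mu s j)%:C%C.
have cE : (\esum_(j in [set` nmul])
     (Normc.normc (coef g phi x j) ^+ 2 * mua mu (2 *: s) j)%:E =
   \esum_(j in [set` nmul]) (Normc.normc (c j) ^+ 2)%:E)%E.
  apply: eq_esum => j j0; congr EFin.
  rewrite mua_scale2// /c Normc.normcM exprMn; congr (_ * _).
  by rewrite [RHS]normc_sqr/= expr0n addr0.
rewrite cE -(L2_sums_norm e2 eo (y := laplace_pow g mu phi s x))//.
(* Existence of a sum rules out the default 0; Parseval then gives the same norm for whichever sum
   is selected. *)
apply: xgetPex; apply: (Riesz_Fischer e2 eo (c := c)).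
by rewrite -cE.
Qed.

Lemma L2_phia n : L2 (vola g a) (phia phi n).
Proof.
split; first exact: e_orthonormal.1.
by have [+ _] := Lfun_addr_closed (vola g a) (lee1n 2); exact.
Qed.

Lemma coef_phia n j : coef g phi (phia phi n) j = (n == j)%:R.
Proof.
rewrite /coef /cinner/=.
under eq_Rintegral do rewrite oppr0 mulr0 subr0.
rewrite e_orthonormal.2.
under eq_Rintegral do rewrite oppr0 mulr0 mul0r addr0.
by rewrite Rintegral_cst// mul0r; case: (n == j).
Qed.

Lemma esum_coef_phia s n : n \in nmul ->
  (\esum_(j in [set` nmul])
     (Normc.normc (coef g phi (phia phi n) j) ^+ 2 * mua mu s j)%:E =
   (mua mu s n)%:E)%E.
Proof.
move=> n0; set f := fun j : a.-tuple nat => (if j == n then mua mu s n else 0)%:E.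
transitivity (\esum_(j in [set` nmul]) f j)%E.
  apply: eq_esum => j _; rewrite coef_phia /f eq_sym; case: eqVneq => [->|_].
    by rewrite Normc.normc1 expr1n mul1r.
  by rewrite Normc.normc0 expr0n mul0r.
(* Isolates the only nonzero term. *)
rewrite (esumID [set n]); last first.
  by move=> j _; rewrite /f lee_fin; case: ifP => // _; exact/ltW/mua_gt0.
rewrite setIC (_ : _ `&` _ = [set n]); last first.
  by apply/seteqP; split=> [j []//|j ->].
rewrite esum_set1 /f eqxx; last by rewrite lee_fin ltW// mua_gt0.
by rewrite esum1 ?adde0// => j [_ /= /eqP /negbTE ->].
Qed.

Lemma H0_phia s n : n \in nmul -> H0 g mu phi s (phia phi n).
Proof.
move=> n0; split; first exact: L2_phia.
  move=> j j0; rewrite coef_phia; case: eqVneq => // nj.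
  by rewrite -nj n0 in j0.
by rewrite esum_coef_phia// ltry.
Qed.

Lemma L2norm_laplace_pow_phia s n : n \in nmul ->
  L2norm (vola g a) (laplace_pow g mu phi s (phia phi n)) = mua mu s n.
Proof.
move=> n0; apply/eqP; rewrite -(@eqrXn2 _ 2) ?L2norm_ge0 ?ltW ?mua_gt0//.
apply/eqP/EFin_inj; rewrite L2norm_laplace_pow; last exact: H0_phia.
by rewrite esum_coef_phia// mua_scale2.
Qed.

Lemma laplace_pow_interpolation m (lam : 'I_m -> R) (r : 'I_m -> 'rV[R]_a)
    (k : 'rV[R]_a) x : k = \sum_l lam l *: r l ->
  (forall l, 0 < lam l) -> \sum_l lam l = 1 ->
  (forall l, H0 g mu phi (2 *: r l) x) ->
  H0 g mu phi (2 *: k) x /\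
  L2norm (vola g a) (laplace_pow g mu phi k x) <=
  \prod_l L2norm (vola g a) (laplace_pow g mu phi (r l) x) `^ lam l.
Proof.
move=> kE lam0 lam1 Hx.
pose N l := L2norm (vola g a) (laplace_pow g mu phi (r l) x).
pose c j := Normc.normc (coef g phi x j) ^+ 2.
have wk j : j \in nmul ->
    mua mu (2 *: k) j = \prod_l mua mu (2 *: r l) j `^ lam l.
  move=> j0; rewrite -mua_lincomb// kE scaler_sumr; congr mua.
  by apply: eq_bigr => l _; rewrite !scalerA mulrC.
have le_k : (\esum_(j in [set` nmul]) (c j * mua mu (2 *: k) j)%:E
    <= (\prod_l (N l ^+ 2) `^ lam l)%:E)%E.
  apply: esum_le_fsets => F; rewrite lee_fin.
  rewrite (eq_bigr _ (fun j mulj => congr1 ( *%R (c j)) (wk j mulj))).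
  apply: hoelder_fsets => // [j|l j j0|l {}F]; first exact: sqr_ge0.
    exact: mua_gt0.
  rewrite -lee_fin L2norm_laplace_pow//.
  exact: (fset_le_esum _ (fun j => c j * mua mu (2 *: r l) j)).
have Hk : H0 g mu phi (2 *: k) x.
  (* Square integrability and the vanishing coefficients come from any one of the spaces in [Hx];
     there is one because an empty sum of [lam] would be 0, not 1. *)
  have m0 : (0 < m)%N.
    rewrite lt0n; apply/eqP => m0; move/eqP: lam1.
    rewrite big1 ?(eq_sym 0) ?oner_eq0// => l _.
    by have := ltn_ord l; rewrite [X in (_ < X)%N]m0.
  have [x2 xc _] := Hx (Ordinal m0).
  by split=> //; apply: le_lt_trans le_k _; rewrite ltry.
split=> //.
rewrite -(@ler_pXn2r _ 2)// ?nnegrE ?L2norm_ge0//; last first.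
  by apply: prodr_ge0 => l _; exact: powR_ge0.
rewrite -lee_fin L2norm_laplace_pow//; apply: le_trans le_k _.
rewrite lee_fin -prodrXl le_eqVlt; apply/orP; left; apply/eqP.
apply: eq_bigr => l _; rewrite -/(N l).
by rewrite -!powR_mulrn ?powR_ge0 ?L2norm_ge0// -!powRrM mulrC.
Qed.

End powers_theory.

(** Membership of x in the space for 2k belongs to the first claim: without it [laplace_pow] could
    be the default 0 and the inequality would be empty. *)
Theorem theorem11 (R : realType) (d : nat) (M : ptopologicalType)
    (g : closed_riemannian_manifold R d M)
    (mu : nat -> R) (phi : nat -> M -> R) (hphi : eigenbasis g mu phi)
    (a : nat) (ha : (0 < a)%N) (m : nat)
    (k : 'rV[R]_a) (r : 'I_m.+1 -> 'rV[R]_a) (lam : 'I_m.+1 -> R)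
    (hlam : forall j, 0 < lam j) (hlam1 : \sum_j lam j = 1)
    (hk : k = \sum_j lam j *: r j) :
  let norm := L2norm (vola g a) in
  let Delta := laplace_pow g mu phi in
  let H := fun s : 'rV[R]_a => H0 g mu phi s in
  [/\ forall x, (forall j, H (2 *: r j) x) ->
        H (2 *: k) x /\
        norm (Delta a k x) <= \prod_j norm (Delta a (r j) x) `^ lam j,
      forall C : R,
        (forall x, (forall j, H (2 *: r j) x) ->
           norm (Delta a k x) <= C * \prod_j norm (Delta a (r j) x) `^ lam j) ->
        1 <= C
    & forall n : a.-tuple nat, (\prod_(i < a) tnth n i != 0)%N ->
        (forall j, H (2 *: r j) (phia phi n)) /\
        norm (Delta a k (phia phi n)) =
        \prod_j norm (Delta a (r j) (phia phi n)) `^ lam j].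
Proof.
move=> norm Delta H.
have phiaE (n : a.-tuple nat) : n \in @nmul a ->
    norm (Delta a k (phia phi n)) =
    \prod_j norm (Delta a (r j) (phia phi n)) `^ lam j.
  move=> n0; rewrite [LHS](L2norm_laplace_pow_phia hphi)// hk (mua_lincomb hphi)//.
  by apply: eq_bigr => j _; rewrite [norm _](L2norm_laplace_pow_phia hphi).
split=> [x Hx|C hC|n n0].
- exact: laplace_pow_interpolation.
(* The multi-index (1, ..., 1) has no zero entry; both sides are then the same positive number up to
   C, which can be divided out. *)
- pose n := nseq_tuple a 1%N.
  have n0 : n \in @nmul a.
    by rewrite inE big1// => i _; rewrite tnth_nseq.
  have := hC (phia phi n) (fun j => H0_phia hphi (2 *: r j) n0).
  rewrite -phiaE// [norm _](L2norm_laplace_pow_phia hphi)//.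
  by rewrite -[leLHS]mul1r ler_pM2r// (mua_gt0 hphi).
by split=> [j|]; [exact: H0_phia|exact: phiaE].
Qed.
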